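(* Let $d\ge 1$ be an integer and let $\mu$ be a Borel probability measure on $\mathbb{R}^d$. Let $X_1,X_2,\ldots$ be i.i.d. random vectors with law $\mu$, and for $n\geq 1$ let $\nu_n$ be the distribution of the scaled sum $S_n=\frac{1}{\sqrt{n}}\sum_{i=1}^n X_i$. Then the sequence $(C_{LS}(\nu_n))_{n\geq 1}$ is weakly decreasing in $n$, i.e. $C_{LS}(\nu_{n+1})\leq C_{LS}(\nu_n)$ for all $n\geq 1$ (as elements of $[0,\infty]$).
   Context: A Borel probability measure $\mu$ on $\mathbb{R}^d$ satisfies the logarithmic Sobolev inequality with constant $C\ge 0$ when $$\operatorname{Ent}_\mu(f^2) := \int f^2\log f^2\,d\mu - \left(\int f^2\,d\mu\right) \log\left(\int f^2\,d\mu\right) \leq 2C\int |\nabla f|^2\,d\mu$$ for all smooth compactly supported test functions $f:\mathbb{R}^d\to\mathbb{R}$ (with $0\log 0=0$; $|\cdot|$ is the Euclidean norm). The smallest such constant $C$ is the log-Sobolev constant $C_{LS}(\mu)\in[0,\infty]$, with $C_{LS}(\mu)=\infty$ if no such inequality holds. *)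

(* Defs.v *)
From HB Require Import structures.
From mathcomp Require Import all_boot all_order all_algebra finmap.
From mathcomp Require Import all_classical all_reals all_analysis.
From mathcomp Require Import measurable_realfun.

Set Implicit Arguments.
Unset Strict Implicit.
Unset Printing Implicit Defensive.

Import Order.TTheory GRing.Theory Num.Theory.
Import numFieldTopology.Exports numFieldNormedType.Exports.

Local Open Scope classical_set_scope.
Local Open Scope ring_scope.

(* R^d with its Borel sigma-algebra. The norm that the library puts on 'rV[R]_d
   is the sup norm; it induces the usual topology, so open sets, compactness,
   continuity and differentiability are the usual ones. Euclidean lengths are
   always written out as sums of squares. *)
Notation borelRd R d := (g_sigma_algebraType (@open 'rV[R]_d)).

Section log_sobolev.
Context {R : realType} {d : nat}.
Implicit Types (f : 'rV[R]_d -> R) (mu : probability (borelRd R d) R).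

Definition partial (i : 'I_d) f : 'rV[R]_d -> R := 'D_(delta_mx 0 i) f.

Fixpoint Ck (k : nat) f : Prop :=
  if k is k'.+1 then
    (forall x, differentiable f x) /\ (forall i, Ck k' (partial i f))
  else continuous f.

Definition smooth f : Prop := forall k, Ck k f.

Definition compactly_supported f : Prop := compact (closure [set x | f x != 0]).

Definition sqnorm_grad f (x : 'rV[R]_d) : R := \sum_(i < d) partial i f x ^+ 2.

(* [ln 0 = 0] in the library, so 0 log 0 = 0 in both terms. *)
Definition Ent_sq mu f : R :=
  \int[mu]_x (f x ^+ 2 * ln (f x ^+ 2))
  - (\int[mu]_x (f x ^+ 2)) * ln (\int[mu]_x (f x ^+ 2)).

Definition log_sobolev mu (C : R) : Prop :=
  forall f, smooth f -> compactly_supported f ->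
    Ent_sq mu f <= 2 * C * \int[mu]_x sqnorm_grad f x.

(* The infimum of the empty set is +oo; a nonempty set of admissible constants
   is closed, so that the infimum is then the smallest one. *)
Definition C_LS mu : \bar R :=
  ereal_inf [set C%:E | C in [set C : R | 0 <= C /\ log_sobolev mu C]].

End log_sobolev.

Definition mutually_independent {I : choiceType} {dO dT : measure_display}
    {Omega : measurableType dO} {T : measurableType dT} {R : realType}
    (P : probability Omega R) (X : I -> {RV P >-> T}) : Prop :=
  forall (J : {fset I}) (A : I -> set T), (forall i, measurable (A i)) ->
    P (\bigcap_(i in [set` J]) X i @^-1` A i)
    = (\prod_(i <- J) P (X i @^-1` A i))%E.

Definition has_law {dO dT : measure_display}
    {Omega : measurableType dO} {T : measurableType dT} {R : realType}
    (P : probability Omega R) (X : {RV P >-> T}) (mu : probability T R) : Prop :=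
  forall A, measurable A -> distribution P X A = mu A.

Section borelRd_measurability.
Context {R : realType} {d : nat}.

Lemma measurable_coord (i : 'I_d) :
  measurable_fun [set: borelRd R d] (fun x : borelRd R d => x ord0 i : R).
Proof.
apply: (measurability _ (RGenOInfty.measurableE R)) => _ [_ [x ->] <-].
rewrite setTI; apply: sub_sigma_algebra.
have /continuousP := @coord_continuous R 1 d ord0 i.
by apply; exact: interval_open.
Qed.

Lemma measurable_borelRd dO (Omega : measurableType dO)
    (g : Omega -> borelRd R d) :
  (forall i, measurable_fun [set: Omega] (fun w => g w ord0 i : R)) ->
  measurable_fun [set: Omega] g.
Proof.
move=> mg; apply: (@measurability _ _ _ (borelRd R d) _ g (@open 'rV[R]_d) erefl) => _ [U oU <-].
pose box (q : {ffun 'I_d -> rat * rat}) : set 'rV[R]_d :=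
  [set x | forall i, x ord0 i \in `]ratr (q i).1, ratr (q i).2[].
rewrite setTI.
have -> : g @^-1` U = \bigcup_q (g @^-1` [set x | box q `<=` U /\ box q x]).
  apply/seteqP; split => [w Uw|w [q _] /= [qU qw]]; last exact: qU.
  have /nbhs_ballP[e /= e0 eU] : nbhs (g w : 'rV[R]_d) U.
    by apply: open_nbhs_nbhs; split.
  have /(_ _)/cid-/all_sig[q qP] : forall i, exists r : rat * rat,
      ((g w : 'rV[R]_d) ord0 i - e < ratr r.1 < (g w : 'rV[R]_d) ord0 i) /\
      ((g w : 'rV[R]_d) ord0 i < ratr r.2 < (g w : 'rV[R]_d) ord0 i + e).
    move=> i; set y := (g w : 'rV[R]_d) ord0 i.
    have /rat_in_itvoo[r1] : y - e < y by rewrite ltrBlDr ltrDl.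
    have /rat_in_itvoo[r2] : y < y + e by rewrite ltrDl.
    by rewrite !in_itv/= => r2P r1P; exists (r1, r2).
  exists (finfun q) => //=; split => [x xq|i]; last first.
    by rewrite ffunE in_itv/=; have [/andP[_ ->] /andP[->]] := qP i.
  apply: eU; split => // i j; rewrite (ord1 i) /ball/= ltr_distlC.
  have := xq j; rewrite ffunE in_itv/= => /andP[q1x xq2].
  have [/andP[eq1 _] /andP[_ q2e]] := qP j.
  by rewrite (lt_trans eq1 q1x) (lt_trans xq2 q2e).
apply: countable_bigcupT_measurable => [|q]; first exact: countableP.
have [qU|nqU] := pselect (box q `<=` U); last first.
  rewrite (_ : _ @^-1` _ = set0)//.
  by apply/seteqP; split => // w [].
rewrite (_ : _ @^-1` _ = \bigcap_(i in [set: 'I_d])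
    ((fun w => g w ord0 i : R) @^-1` `]ratr (q i).1, ratr (q i).2[)); last first.
  by apply/seteqP; split => [w [_ qw] i _|w qw]; [exact: qw|split=> // i; exact: qw].
apply: fin_bigcap_measurable => [|i _]; first exact: finite_finset.
by rewrite -[X in measurable X]setTI; apply: mg.
Qed.

End borelRd_measurability.

Section scaled_sum.
Context {R : realType} {d : nat} {dO : measure_display}
  {Omega : measurableType dO} {P : probability Omega R}.
Variable X : nat -> {RV P >-> borelRd R d}.

(* The sequence X_1, X_2, ... is indexed from 0. *)
Definition scaled_sum (n : nat) (w : Omega) : borelRd R d :=
  (Num.sqrt n%:R)^-1 *: (\sum_(i < n) (X i w : 'rV[R]_d)).

Lemma measurable_scaled_sum n : measurable_fun [set: Omega] (scaled_sum n).
Proof.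
apply: measurable_borelRd => i.
rewrite (_ : (fun _ => _) = fun w : Omega =>
  (Num.sqrt n%:R)^-1 * \sum_(k < n) ((X k w : 'rV[R]_d) ord0 i)); last first.
  by apply/funext => w; rewrite /scaled_sum mxE summxE.
apply: measurable_funM => //.
apply: measurable_sum => k.
exact: (measurableT_comp (measurable_coord i) (measurable_funPT (X k))).
Qed.

HB.instance Definition _ n :=
  isMeasurableFun.Build _ _ Omega (borelRd R d) (scaled_sum n)
    (measurable_scaled_sum n).

End scaled_sum.

(* Main.v *)
From HB Require Import structures.
Require Import Defs.
From mathcomp Require Import all_boot all_order all_algebra finmap.
From mathcomp Require Import all_classical all_reals all_analysis.
From mathcomp Require Import measurable_realfun ring lra.
Import numFieldTopology.Exports numFieldNormedType.Exports.

(** The monotonicity comes from Han's inequality for the entropy of a product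
    measure. Write T_s for the sum of the X_i with i in s, let f be a test
    function, F y = f (y / sqrt (n+1)) ^ 2, G = F (T_{0..n}), and let
    phi t = t ln t.

    Han's inequality. Deleting one variable X_i leaves a sum of n variables,
    and g x = E F (T_{0..n-1} + x) is the conditional expectation of G given
    X_i = x: by exchangeability it is the same function for every i. The
    product H of the n+1 variables g (X_i) / m, where m = E G, times m has
    expectation m, so Gibbs' inequality E [G ln (G / H')] >= E G - E H' with
    H' = m H reads
      (n+1) E phi (g (X_n)) <= E phi G + n phi (E G),
    because E [G ln g (X_i)] = E phi (g (X_n)). To keep every logarithm
    bounded, g and m are replaced by g + eps and m + eps inside the logarithms
    and eps is then sent to 0; this is [han_inequality].

    One step of the logarithmic Sobolev inequality. For fixed x the function
    s |-> f (a s + x / sqrt (n+1)) with a ^ 2 = n / (n+1) is again a test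
    function ([smooth_affine], [compactly_supported_affine]), and its squared
    gradient carries the factor a ^ 2. The inequality for the law of the n-th
    scaled sum, applied to it and integrated over x = X_n, gives
      E phi G - E phi (g (X_n)) <= 2 C n / (n+1) E |grad f| ^ 2.
    Adding n+1 times this to Han's inequality yields
      n (E phi G - phi (E G)) <= 2 C n E |grad f| ^ 2,
    which is the inequality for the (n+1)-st scaled sum with the same constant
    ([log_sobolev_scaled_sumS]). Hence the set of admissible constants can only
    grow with n.

    The probabilistic input is that T_s and X_i are independent for i outside
    s, and that the law of T_s depends only on the size of s. Both are proved
    for any statistic obtained by feeding the variables one at a time into a
    measurable update ([fold_stat_indep], [fold_stat_law]): the update
    u |-> u + x gives the sums, and u |-> u * h x gives the expectation of the
    product H. *)

Set Implicit Arguments.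
Unset Strict Implicit.
Unset Printing Implicit Defensive.

Import Order.TTheory GRing.Theory Num.Theory.

Local Open Scope classical_set_scope.
Local Open Scope ring_scope.

(** * Affine changes of variable in test functions *)

Section test_functions.
Context {R : realType} {d : nat}.
Implicit Types (f : 'rV[R]_d -> R) (a b : R) (y : 'rV[R]_d).

Lemma continuous_measurable_borelRd f :
  continuous f -> measurable_fun [set: borelRd R d] (f : borelRd R d -> R).
Proof.
move=> /continuousP cf; apply: (measurability _ (RGenOInfty.measurableE R)).
move=> _ [_ [x ->] <-]; rewrite setTI; apply: sub_sigma_algebra.
by apply: cf; exact: interval_open.
Qed.

Lemma continuous_affine a y : continuous (fun s : 'rV[R]_d => a *: s + y).
Proof. by move=> x; apply: continuousD; [exact: scaler_continuous|exact: cst_continuous]. Qed.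

Lemma diff_affine f a b y x : differentiable f (a *: x + y) ->
  is_diff x (fun s => b * f (a *: s + y)) (b *: ('d f (a *: x + y) \o ( *:%R a))).
Proof.
move=> df.
have da : is_diff x (fun s : 'rV[R]_d => a *: s + y) ( *:%R a).
  by apply: is_diff_eq; rewrite addr0.
have df' : is_diff (a *: x + y) f ('d f (a *: x + y)) by exact: differentiableP.
have := is_diffZ b (is_diff_comp da df').
by [].
Qed.

Lemma partial_affine f a b y (i : 'I_d) : (forall x, differentiable f x) ->
  partial i (fun s => b * f (a *: s + y)) =
  (fun s => (b * a) * partial i f (a *: s + y)).
Proof.
move=> df; apply/funext => x; rewrite /partial.
have [dg dgE] := @diff_affine f a b y x (df _).
rewrite deriveE// dgE deriveE; last exact: df.
rewrite (_ : (_ *: _) _ = b *: 'd f (a *: x + y) (a *: delta_mx 0 i))//.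
by rewrite linearZ scalerA.
Qed.

(** Each derivative brings out a factor [a]; the constant [b] absorbs it, so that
    the statement is stable under taking partial derivatives. *)
Lemma Ck_affine k f a b y : Ck k f -> Ck k (fun s => b * f (a *: s + y)).
Proof.
elim: k f b => [|k IH] f b /= => [cf x|[df cf]].
  apply: continuousM; first exact: cst_continuous.
  by apply: continuous_comp; [exact: continuous_affine|exact: cf].
split=> [x|i]; first by case: (@diff_affine f a b y x (df _)).
by rewrite partial_affine//; exact: IH.
Qed.

Lemma smooth_affine f a y : smooth f -> smooth (fun s => f (a *: s + y)).
Proof.
move=> sf k; rewrite (_ : (fun _ => _) = fun s => 1 * f (a *: s + y)).
  exact: Ck_affine.
by apply/funext => s; rewrite mul1r.
Qed.

(** The support is contained in the image of the support of [f] under the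
    inverse affine map. *)
Lemma compactly_supported_affine f a y : a != 0 -> compactly_supported f ->
  compactly_supported (fun s => f (a *: s + y)).
Proof.
move=> a0 cf; rewrite /compactly_supported.
set K := closure [set x | f x != 0] in cf.
pose u (s : 'rV[R]_d) := a^-1 *: s + - (a^-1 *: y).
have cu : compact (u @` K).
  apply: continuous_compact => //; apply: continuous_subspaceT.
  exact: continuous_affine.
apply: (subclosed_compact _ cu); first exact: closed_closure.
apply: (@subset_trans _ (closure (u @` K))).
  apply: closureS => s /= fs; exists (a *: s + y).
    exact: subset_closure.
  by rewrite /u scalerDr addrK scalerA mulVf// scale1r.
by rewrite -(iffLR (closure_id _))//; exact: compact_closed.
Qed.

Lemma sqnorm_grad_affine f a y x : (forall x, differentiable f x) ->
  sqnorm_grad (fun s => f (a *: s + y)) x = a ^+ 2 * sqnorm_grad f (a *: x + y).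
Proof.
move=> df; rewrite /sqnorm_grad mulr_sumr; apply: eq_bigr => i _.
rewrite (_ : (fun _ => _) = fun s => 1 * f (a *: s + y)); last first.
  by apply/funext => s; rewrite mul1r.
by rewrite partial_affine// mul1r exprMn.
Qed.

Lemma bounded_of_compact_support f (K : set 'rV[R]_d) : continuous f ->
  compact K -> (forall x, ~ K x -> f x = 0) -> exists M, forall x, `|f x| <= M.
Proof.
move=> cf cK f0.
have : bounded_set (f @` K).
  by apply: compact_bounded; apply: continuous_compact => //;
    exact: continuous_subspaceT.
case/ex_strict_bound_gt0 => M M0 Mf; exists M => x.
have [Kx|/f0 ->] := pselect (K x); last by rewrite normr0 ltW.
by apply/ltW/Mf; exists x.
Qed.

Lemma partial_out_support f i x : ~ closure [set x | f x != 0] x ->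
  partial i f x = 0.
Proof.
move=> nx; rewrite /partial (@near_eq_derive _ _ _ f (cst 0)).
  by rewrite derive_cst.
have /open_nbhs_nbhs : open_nbhs x (~` closure [set x | f x != 0]).
  by split => //; apply: closed_openC; exact: closed_closure.
apply: filterS => z nz; apply/eqP; apply: contrapT => /negP fz.
by apply: nz; exact: subset_closure.
Qed.

End test_functions.

(** * Independence *)

Section joint_law.
Context {R : realType} {dO dS dE : measure_display} {Omega : measurableType dO}
  {S : measurableType dS} {E : measurableType dE} {P : probability Omega R}.
Implicit Types (V : {RV P >-> S}) (Y : {RV P >-> E}).

Definition independent2 V Y := forall A B, measurable A -> measurable B ->
  P (V @^-1` A `&` Y @^-1` B) = (P (V @^-1` A) * P (Y @^-1` B))%E.

(** A measure on the product is determined by its values on rectangles. *)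
Lemma joint_law V Y : independent2 V Y -> forall D, measurable D ->
  (distribution P V \x distribution P Y)%E D = P ((fun w => (V w, Y w)) @^-1` D).
Proof.
move=> VY D mD.
have mVY : measurable_fun setT (fun w => (V w, Y w)) by exact: measurable_fun_pair.
pose Z := mfun_Sub (mem_set mVY : _ \in mfun).
rewrite (product_measure_unique (m' := distribution P Z))//.
Qed.

(** The inner variable is an independent copy: integrating [V] and [Y] on the
    same space is the same as integrating them on two copies of it. *)
Lemma tonelli_independent V Y (phi : S * E -> \bar R) : independent2 V Y ->
  measurable_fun setT phi -> (forall z, 0 <= phi z)%E ->
  (\int[P]_w phi (V w, Y w) = \int[P]_w' \int[P]_w phi (V w, Y w'))%E.
Proof.
move=> VY mphi phi0.
have mVY : measurable_fun setT (fun w => (V w, Y w)) by exact: measurable_fun_pair.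
pose Z : {RV P >-> _} := mfun_Sub (mem_set mVY : _ \in mfun).
transitivity (\int[distribution P Z]_z phi z)%E.
  by rewrite ge0_integral_distribution.
rewrite (eq_measure_integral (distribution P V \x distribution P Y)%E); last first.
  move=> A mA _; exact/esym/(joint_law VY mA).
rewrite fubini_tonelli2// ge0_integral_distribution//; last 2 first.
- exact: measurable_fun_fubini_tonelli_G.
- by move=> y; exact: integral_ge0.
apply: eq_integral => w' _ /=; rewrite /fubini_G ge0_integral_distribution//.
exact: measurableT_comp.
Qed.

End joint_law.

Lemma eq_product_measure {R : realType} {dS dE : measure_display}
    {S : measurableType dS} {E : measurableType dE}
    (m1 m1' : probability S R) (m2 m2' : probability E R) :
  (forall A, measurable A -> m1 A = m1' A) ->
  (forall A, measurable A -> m2 A = m2' A) ->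
  forall D, measurable D -> (m1 \x m2)%E D = (m1' \x m2')%E D.
Proof.
move=> e1 e2 D mD; apply: product_measure_unique => // A B mA mB.
rewrite [LHS]product_measure1E//.
by congr (_ * _)%E; [exact/esym/e1|exact/esym/e2].
Qed.

Section fold_statistic.
Context {R : realType} {dO dS dE : measure_display} {Omega : measurableType dO}
  {S : measurableType dS} {E : measurableType dE} {P : probability Omega R}
  {I : choiceType}.
Variables (op : {mfun (S * E)%type >-> S}) (u0 : S) (X : I -> {RV P >-> E}).

(** The update [op] is left abstract so that one independence statement covers
    both the sums and the products of functions of the [X i]. *)
Definition fold_stat (s : seq I) (w : Omega) : S :=
  foldr (fun i u => op (u, X i w)) u0 s.

Lemma measurable_fold_stat s : measurable_fun setT (fold_stat s).
Proof.
elim: s => [|i s IH]; first exact: measurable_cst.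
by apply: measurableT_comp => //; exact: measurable_fun_pair.
Qed.

HB.instance Definition _ s :=
  isMeasurableFun.Build _ _ Omega S (fold_stat s) (measurable_fold_stat s).

Hypothesis indX : mutually_independent X.

Let event (J : {fset I}) (A : I -> set E) :=
  \bigcap_(i in [set` J]) X i @^-1` A i.

Let measurable_event J A : (forall i, measurable (A i)) -> measurable (event J A).
Proof.
move=> mA; apply: fin_bigcap_measurable => [|i _]; first exact: finite_fset.
by rewrite -[X in measurable X]setTI; exact: measurable_funPT.
Qed.

Let event1 i (B : set E) : event [fset i]%fset (fun=> B) = X i @^-1` B.
Proof.
apply/seteqP; split => [w /(_ i)|w wi j /=]; first by apply; rewrite /= inE.
by rewrite inE => /eqP ->.
Qed.

(** Induction on [s], with all events on the unused variables at once: for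
    [i :: s] and a fixed event e on the variables outside [i :: s], the
    induction hypothesis, applied to e and {X i in A0} together, says that the
    law of the pair (state, X i) restricted to e is P(e) times the product of
    the two laws on rectangles, hence everywhere, hence on the preimage of [B]
    under the update. *)
Lemma fold_stat_indep s (J : {fset I}) (A : I -> set E) (B : set S) :
  uniq s -> {in J, forall i, i \notin s} ->
  (forall i, measurable (A i)) -> measurable B ->
  P (fold_stat s @^-1` B `&` event J A)
  = (P (fold_stat s @^-1` B) * P (event J A))%E.
Proof.
elim: s J A B => [J A B _ _ mA mB|i s IH J A B /= /andP[si us] Js mA mB].
  have [Bu|nBu] := pselect (B u0).
    rewrite (_ : fold_stat [::] @^-1` B = setT); last by apply/seteqP; split.
    by rewrite setTI probability_setT mul1e.
  rewrite (_ : fold_stat [::] @^-1` B = set0); last by apply/seteqP; split.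
  by rewrite set0I measure0 mul0e.
have mEJ := measurable_event J mA.
have iJ : i \notin J.
  by apply/negP => iJ; have := Js _ iJ; rewrite inE eqxx.
have rect B' A0 : measurable B' -> measurable A0 ->
    P (fold_stat s @^-1` B' `&` X i @^-1` A0 `&` event J A) =
    (P (fold_stat s @^-1` B') * P (X i @^-1` A0) * P (event J A))%E.
  move=> mB' mA0; pose A' j := if j == i then A0 else A j.
  have mA' j : measurable (A' j) by rewrite /A'; case: ifP.
  have A'J : \bigcap_(j in [set` (i |` J)%fset]) X j @^-1` A' j =
      X i @^-1` A0 `&` event J A.
    apply/seteqP; split => [w Hw|w [wi wJ] j /=].
      split; first by have := Hw i; rewrite /= /A' eqxx; apply; rewrite !inE eqxx.
      move=> j /= jJ; have := Hw j; rewrite /= /A' !inE jJ orbT => /(_ isT).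
      by case: eqP => // ji; rewrite -ji jJ in iJ.
    rewrite !inE /A' => /orP[/eqP ->|jJ]; first by rewrite eqxx.
    by case: eqP => [->//|_]; exact: wJ.
  rewrite -setIA -A'J IH//; last first.
    move=> j; rewrite !inE => /orP[/eqP ->//|/Js].
    by rewrite inE negb_or => /andP[].
  rewrite indX// big_fsetU1//= -muleA; congr (_ * (_ * _))%E.
    by rewrite /A' eqxx.
  rewrite /event indX//; apply: eq_big_seq => j jJ.
  by rewrite /A'; case: eqP => // ji; rewrite -ji jJ in iJ.
have ind2 : independent2 (fold_stat s : {RV P >-> S}) (X i).
  move=> B' A0 mB' mA0.
  by rewrite -event1 IH// => j; rewrite inE => /eqP ->.
have mop : measurable (op @^-1` B).
  by rewrite -[X in measurable X]setTI; exact: measurable_funPT.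
(* The restricted law has total mass P(e), so it is compared with the product
   of the laws whose first factor is scaled by P(e). *)
pose r : {nonneg R} := NngNum (fine_ge0 (measure_ge0 P (event J A))).
have rE : P (event J A) = (r%:num)%:E by rewrite /= fineK// fin_num_measure.
have mZ : measurable_fun setT (fun w => (fold_stat s w, X i w)).
  by apply: measurable_fun_pair => //; exact: measurable_fold_stat.
pose Z : {mfun Omega >-> (S * E)%type} := mfun_Sub (mem_set mZ : _ \in mfun).
have E1 : (mscale r (distribution P (fold_stat s : {RV P >-> S})) \x
    distribution P (X i))%E (op @^-1` B) =
    P (fold_stat (i :: s) @^-1` B `&` event J A).
  apply: (@product_measure_unique _ _ S E R
    (mscale r (distribution P (fold_stat s : {RV P >-> S})))
    (distribution P (X i)) (pushforward (mrestr P mEJ) Z)) => // B' A0 mB' mA0.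
  by rewrite [LHS](rect B' A0)// rE /mscale/= muleC muleA.
rewrite -E1 rE.
have -> : P (fold_stat (i :: s) @^-1` B) =
  (distribution P (fold_stat s : {RV P >-> S}) \x distribution P (X i))%E
    (op @^-1` B) by rewrite joint_law.
rewrite muleC /product_measure1/= ge0_integral_mscale//.
exact: measurable_fun_xsection.
Qed.

Lemma fold_stat_indep_next s i : uniq (i :: s) ->
  independent2 (fold_stat s : {RV P >-> S}) (X i).
Proof.
move=> /= /andP[si us] B A mB mA.
by rewrite -event1 fold_stat_indep// => j; rewrite inE => /eqP ->.
Qed.

(** The state and the next variable are independent, so their joint law, and
    with it the law of the next state, depends only on the two marginals. *)
Lemma fold_stat_law (mu : probability E R) s t : (forall i, has_law (X i) mu) ->
  uniq s -> uniq t -> size s = size t -> forall B, measurable B ->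
  P (fold_stat s @^-1` B) = P (fold_stat t @^-1` B).
Proof.
move=> lawX; elim: s t => [[]//|i s IH [//|j t]] us ut [st] B mB.
have mop : measurable (op @^-1` B).
  by rewrite -[X in measurable X]setTI; exact: measurable_funPT.
have /esym := @joint_law _ _ _ _ _ _ _ _ _ _ (fold_stat_indep_next us) _ mop.
have /esym := @joint_law _ _ _ _ _ _ _ _ _ _ (fold_stat_indep_next ut) _ mop.
rewrite /= => -> ->; apply: eq_product_measure => // A mA.
- by apply: IH => //; [case/andP: us|case/andP: ut].
- by rewrite [LHS]lawX// [RHS]lawX.
Qed.

End fold_statistic.

(** * Expectations of bounded measurable functions *)

Section bounded_measurable.
Context {R : realType}.

(** Boundedness holds everywhere, not just almost everywhere, so that sections
    and compositions of such functions are again bounded; for a probability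
    measure they are integrable. *)
Definition bounded_measurable {dT} {T : measurableType dT} (f : T -> R) : Prop :=
  measurable_fun setT f /\ exists M, forall x, `|f x| <= M.

Context {dT} {T : measurableType dT}.
Implicit Types f g : T -> R.

Lemma bm_cst r : bounded_measurable (fun _ : T => r).
Proof. by split=> //; exists `|r|. Qed.

Lemma bmD f g : bounded_measurable f -> bounded_measurable g ->
  bounded_measurable (fun x => f x + g x).
Proof.
move=> [mf [M fM]] [mg [N gN]]; split; first exact: measurable_funD.
by exists (M + N) => x; rewrite (le_trans (ler_normD _ _))// lerD.
Qed.

Lemma bmM f g : bounded_measurable f -> bounded_measurable g ->
  bounded_measurable (fun x => f x * g x).
Proof.
move=> [mf [M fM]] [mg [N gN]]; split; first exact: measurable_funM.
by exists (M * N) => x; rewrite normrM ler_pM.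
Qed.

Lemma bmB f g : bounded_measurable f -> bounded_measurable g ->
  bounded_measurable (fun x => f x - g x).
Proof.
move=> [mf [M fM]] [mg [N gN]]; split; first exact: measurable_funB.
by exists (M + N) => x; rewrite (le_trans (ler_normB _ _))// lerD.
Qed.

Lemma bm_sum (I : Type) (s : seq I) (F : I -> T -> R) :
  (forall i, bounded_measurable (F i)) ->
  bounded_measurable (fun x => \sum_(i <- s) F i x).
Proof.
move=> bF; elim: s => [|i s IH].
  by under eq_fun do rewrite big_nil; exact: bm_cst.
by under eq_fun do rewrite big_cons; exact: bmD.
Qed.

Lemma bm_prod (I : Type) (s : seq I) (F : I -> T -> R) :
  (forall i, bounded_measurable (F i)) ->
  bounded_measurable (fun x => \prod_(i <- s) F i x).
Proof.
move=> bF; elim: s => [|i s IH].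
  by under eq_fun do rewrite big_nil; exact: bm_cst.
by under eq_fun do rewrite big_cons; exact: bmM.
Qed.

Lemma bm_comp {dT'} {T' : measurableType dT'} f (u : T' -> T) :
  measurable_fun setT u -> bounded_measurable f ->
  bounded_measurable (fun x => f (u x)).
Proof.
move=> mu [mf [M fM]]; split; first exact: measurableT_comp.
by exists M => x; exact: fM.
Qed.

Lemma bm_ln f e : 0 < e -> (forall x, 0 <= f x) -> bounded_measurable f ->
  bounded_measurable (fun x => ln (f x + e)).
Proof.
move=> e0 f0 [mf [M fM]]; split.
  by apply: measurableT_comp => //; exact: measurable_funD.
exists (`|ln e| + (M + e)) => x.
have fe : 0 < f x + e by rewrite ltr_wpDl.
have le1 : ln e <= ln (f x + e) by rewrite ler_ln ?posrE// lerDr.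
have le2 : ln (f x + e) <= M + e.
  by rewrite (le_trans (ltW (ln_sublinear fe)))// lerD2r (le_trans (ler_norm _)).
have M0 : 0 <= M + e by rewrite addr_ge0 ?(ltW e0)//; exact: le_trans (fM x).
have := ler_norm (- ln e); rewrite normrN => le3; have := normr_ge0 (ln e) => le4.
by rewrite ler_norml; apply/andP; split; lra.
Qed.

Lemma normr_mul_ln_le (t : R) : 0 <= t -> `|t * ln t| <= 1 + t ^+ 2.
Proof.
rewrite le0r => /predU1P[->|t0]; first by rewrite mul0r normr0 addr_ge0// sqr_ge0.
have le1 := ltW (ln_sublinear t0).
have : ln t^-1 <= t^-1 by apply/ltW/ln_sublinear; rewrite invr_gt0.
rewrite lnV// => le2.
have {}le1 : t * ln t <= t ^+ 2 by rewrite expr2 ler_wpM2l// ltW.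
have {}le2 : t * - ln t <= 1.
  by rewrite -(mulfV (lt0r_neq0 t0)) ler_wpM2l// ltW.
by rewrite ler_norml; have := sqr_ge0 t => t2; apply/andP; split; lra.
Qed.

Lemma bm_mul_ln f : (forall x, 0 <= f x) -> bounded_measurable f ->
  bounded_measurable (fun x => f x * ln (f x)).
Proof.
move=> f0 [mf [M fM]]; split.
  by apply: measurable_funM => //; exact: measurableT_comp.
exists (1 + M ^+ 2) => x; rewrite (le_trans (normr_mul_ln_le (f0 x)))//.
have M0 : 0 <= M by exact: le_trans (fM x).
by rewrite lerD2l ler_pXn2r// ?nnegrE// (le_trans (ler_norm _)).
Qed.

Variable P : probability T R.

Lemma bm_integrable f : bounded_measurable f -> P.-integrable setT (EFin \o f).
Proof.
move=> [mf [M fM]]; apply: measurable_bounded_integrable => //.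
  by rewrite (le_lt_trans (probability_le1 P measurableT))// ltry.
exists M; split; first exact: num_real.
by move=> z Mz x _ /=; rewrite (le_trans (fM x))// ltW.
Qed.

Lemma expect_cst r : \int[P]_w r = r.
Proof. by rewrite Rintegral_cst// [X in fine X](probability_setT P) mulr1. Qed.

Lemma expectD f g : bounded_measurable f -> bounded_measurable g ->
  \int[P]_w (f w + g w) = \int[P]_w f w + \int[P]_w g w.
Proof. by move=> bf bg; rewrite RintegralD//; exact: bm_integrable. Qed.

Lemma expectB f g : bounded_measurable f -> bounded_measurable g ->
  \int[P]_w (f w - g w) = \int[P]_w f w - \int[P]_w g w.
Proof. by move=> bf bg; rewrite RintegralB//; exact: bm_integrable. Qed.

Lemma expectZl r f : bounded_measurable f ->
  \int[P]_w (r * f w) = r * \int[P]_w f w.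
Proof. by move=> bf; rewrite RintegralZl//; exact: bm_integrable. Qed.

Lemma expect_sum (I : Type) (s : seq I) (F : I -> T -> R) :
  (forall i, bounded_measurable (F i)) ->
  \int[P]_w (\sum_(i <- s) F i w) = \sum_(i <- s) \int[P]_w F i w.
Proof.
move=> bF; elim: s => [|i s IH].
  by under eq_Rintegral do rewrite big_nil; rewrite expect_cst big_nil.
under eq_Rintegral do rewrite big_cons.
by rewrite expectD ?IH ?big_cons//; exact: bm_sum.
Qed.

Lemma le_expect f g : bounded_measurable f -> bounded_measurable g ->
  (forall w, f w <= g w) -> \int[P]_w f w <= \int[P]_w g w.
Proof. by move=> bf bg fg; apply: le_Rintegral => //; exact: bm_integrable. Qed.

Lemma EFin_expect f : bounded_measurable f ->
  (\int[P]_w f w)%:E = (\int[P]_w (f w)%:E)%E.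
Proof.
by move=> bf; rewrite fineK//; exact/integrable_fin_num/bm_integrable.
Qed.

End bounded_measurable.

Section expectation_transfer.
Context {R : realType} {dO dE : measure_display} {Omega : measurableType dO}
  {E : measurableType dE} {P : probability Omega R}.
Implicit Types (Y : {RV P >-> E}).

Lemma expect_distribution Y (f : E -> R) : bounded_measurable f ->
  \int[distribution P Y]_x f x = \int[P]_w f (Y w).
Proof.
move=> bf; congr fine; rewrite integral_distribution//.
  by apply/measurable_EFinP; case: bf.
exact/(bm_integrable P)/bm_comp.
Qed.

Lemma expect_eq_law Y Y' (f : E -> R) : bounded_measurable f ->
  (forall A, measurable A -> distribution P Y A = distribution P Y' A) ->
  \int[P]_w f (Y w) = \int[P]_w f (Y' w).
Proof.
move=> bf YY'; rewrite -!expect_distribution//; congr fine.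
by apply: eq_measure_integral => A mA _; exact: YY'.
Qed.

End expectation_transfer.

Section fubini_independent.
Context {R : realType} {dO dS dE : measure_display} {Omega : measurableType dO}
  {S : measurableType dS} {E : measurableType dE} {P : probability Omega R}.
Implicit Types (V : {RV P >-> S}) (Y : {RV P >-> E}).

Lemma bm_section V (phi : S * E -> R) : bounded_measurable phi ->
  bounded_measurable (fun y => \int[P]_w phi (V w, y)).
Proof.
move=> bphi.
have bslice y : bounded_measurable (fun w => phi (V w, y)).
  by apply: (bm_comp _ bphi); exact: measurable_fun_pair.
split; last first.
  have [_ [M phiM]] := bphi; exists M => y; rewrite ler_norml; apply/andP; split.
  - rewrite -[leLHS](expect_cst P); apply: le_expect => [|//|w]; first exact: bm_cst.
    by have := phiM (V w, y); rewrite ler_norml => /andP[].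
  - rewrite -[leRHS](expect_cst P); apply: le_expect => [//||w]; first exact: bm_cst.
    by have := phiM (V w, y); rewrite ler_norml => /andP[].
(* Shifting by the bound makes the integrand nonnegative, so that Tonelli's
   measurability statement applies. *)
have [mphi [M phiM]] := bphi.
have : measurable_fun setT
    (fubini_G (distribution P V) (fun z => (phi z + M)%:E)).
  apply: measurable_fun_fubini_tonelli_G => [|z].
    by apply/measurable_EFinP; exact: measurable_funD.
  by rewrite lee_fin; have := phiM z; rewrite ler_norml => /andP[]; lra.
move=> mG.
rewrite (_ : (fun _ => _) = fun y => fine (fubini_G (distribution P V)
    (fun z => (phi z + M)%:E) y) - M).
  by apply: measurable_funB => //; exact: measurableT_comp.
apply/funext => y.
rewrite (_ : fine _ = \int[distribution P V]_v (phi (v, y) + M))//.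
have bphiy : bounded_measurable (fun v => phi (v, y)).
  by apply: (bm_comp _ bphi); exact: measurable_fun_pair.
rewrite expectD//; last exact: bm_cst.
by rewrite expect_cst addrK expect_distribution.
Qed.

Lemma fubini_independent V Y (phi : S * E -> R) : independent2 V Y ->
  bounded_measurable phi ->
  \int[P]_w phi (V w, Y w) = \int[P]_w' \int[P]_w phi (V w, Y w').
Proof.
move=> VY bphi.
have mVY : measurable_fun setT (fun w => (V w, Y w)) by exact: measurable_fun_pair.
pose Z : {RV P >-> (S * E)%type} := mfun_Sub (mem_set mVY : _ \in mfun).
have bphiy y : bounded_measurable (fun v => phi (v, y)).
  by apply: (bm_comp _ bphi); exact: measurable_fun_pair.
transitivity (\int[distribution P Z]_z phi z).
  by rewrite expect_distribution.
transitivity (\int[distribution P Y]_y \int[P]_w phi (V w, y)).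
  congr fine; rewrite (eq_measure_integral (distribution P V \x distribution P Y)%E); last first.
    by move=> A mA _; exact/esym/(joint_law VY mA).
  rewrite -integral21_prod_meas1; last exact: bm_integrable.
  apply: eq_integral => y _; rewrite EFin_expect.
    rewrite /fubini_G -!EFin_expect//; last by apply: (bm_comp _ (bphiy y)).
    by rewrite expect_distribution.
  by apply: (bm_comp _ (bphiy y)).
by rewrite expect_distribution//; exact: bm_section.
Qed.

End fubini_independent.

Section test_function_bounds.
Context {R : realType} {d : nat}.
Implicit Types f : 'rV[R]_d -> R.

Lemma bm_test_function f : smooth f -> compactly_supported f ->
  bounded_measurable (f : borelRd R d -> R).
Proof.
move=> sf cf; have cf0 : continuous f by exact: (sf 0%N).
split; first exact: continuous_measurable_borelRd.
apply: (@bounded_of_compact_support _ _ _ _ cf0 cf) => x nx; apply/eqP.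
by apply: contrapT => /negP fx; apply: nx; exact: subset_closure.
Qed.

Lemma bm_sqnorm_grad f : smooth f -> compactly_supported f ->
  bounded_measurable (sqnorm_grad f : borelRd R d -> R).
Proof.
move=> sf cf; have [_ cpf] := sf 1%N.
apply: bm_sum => i.
have bp : bounded_measurable (partial i f : borelRd R d -> R).
  split; first by apply: continuous_measurable_borelRd; exact: (cpf i).
  by apply: (@bounded_of_compact_support _ _ _ _ (cpf i) cf) => x; exact: partial_out_support.
exact: bmM.
Qed.

End test_function_bounds.

(** * Han's inequality *)

Section entropy.
Context {R : realType}.

(** With r = u / t this is ln r <= r - 1 multiplied by t. *)
Lemma gibbs_pointwise (t u : R) : 0 <= t -> 0 < u ->
  t * ln u + t - u <= t * ln t.
Proof.
rewrite le0r => /predU1P[->|t0] u0; first by rewrite !mul0r add0r sub0r lerNl oppr0 ltW.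
have : ln (1 + (u / t - 1)) <= u / t - 1.
  by apply: le_ln1Dx; rewrite ltrBrDr addNr divr_gt0.
rewrite addrC subrK ln_div ?posrE// => h.
have := ler_wpM2l (ltW t0) h.
rewrite !mulrBr mulr1 mulrCA mulfV ?lt0r_neq0// mulr1; lra.
Qed.

(** Again ln (1 + r) <= r, now with r = e / t; at t = 0 the left side is 0. *)
Lemma mul_lnD_le (t e : R) : 0 <= t -> 0 < e -> t * ln (t + e) <= t * ln t + e.
Proof.
rewrite le0r => /predU1P[->|t0] e0; first by rewrite !mul0r add0r ltW.
have : ln (1 + e / t) <= e / t.
  by apply: le_ln1Dx; rewrite (lt_trans _ (divr_gt0 e0 t0))// ltrN10.
rewrite -{1}(mulfV (lt0r_neq0 t0)) -mulrDl ln_div ?posrE ?addr_gt0// => h.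
have := ler_wpM2l (ltW t0) h.
rewrite mulrBr mulrCA mulfV ?lt0r_neq0// mulr1; lra.
Qed.

Lemma ln_prod (I : Type) (s : seq I) (F : I -> R) : (forall i, 0 < F i) ->
  ln (\prod_(i <- s) F i) = \sum_(i <- s) ln (F i).
Proof.
move=> F0; elim: s => [|i s IH]; first by rewrite !big_nil ln1.
by rewrite !big_cons lnM ?posrE ?prodr_gt0// IH.
Qed.

End entropy.

Section product_expectation.
Context {R : realType} {dO dE : measure_display} {Omega : measurableType dO}
  {E : measurableType dE} {P : probability Omega R} {I : choiceType}.
Variables (h : E -> R) (mh : measurable_fun setT h).

Definition mul_op (z : R * E) : R := z.1 * h z.2.

Lemma measurable_mul_op : measurable_fun setT mul_op.
Proof. by apply: measurable_funM => //; exact: measurableT_comp. Qed.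

HB.instance Definition _ :=
  isMeasurableFun.Build _ _ (R * E)%type R mul_op measurable_mul_op.

Lemma expect_prod (X : I -> {RV P >-> E}) s : mutually_independent X ->
  (forall x, 0 <= h x) -> bounded_measurable h -> uniq s ->
  \int[P]_w (\prod_(i <- s) h (X i w)) = \prod_(i <- s) \int[P]_w h (X i w).
Proof.
move=> indX h0 bh; elim: s => [|i s IH] us.
  by under eq_Rintegral do rewrite big_nil; rewrite expect_cst big_nil.
have bX j : bounded_measurable (fun w => h (X j w)) by exact: bm_comp.
pose U : {RV P >-> R} := fold_stat mul_op 1 X s.
have UE w : U w = \prod_(j <- s) h (X j w).
  rewrite /U; elim: s {us IH U} => [|j s IH]; first by rewrite big_nil.
  by rewrite big_cons -IH; exact: mulrC.
have U0 w : 0 <= U w by rewrite UE prodr_ge0.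
have bU : bounded_measurable U.
  by rewrite (funext UE : (U : Omega -> R) = _); exact: bm_prod.
rewrite big_cons -IH; last by case/andP: us.
under eq_Rintegral do rewrite big_cons -UE.
under [X in _ = _ * X]eq_Rintegral do rewrite -UE.
(* The integrand u * h x is unbounded in u, hence Tonelli rather than Fubini;
   the absolute value makes it nonnegative for every real u. *)
apply: EFin_inj; rewrite EFin_expect; last exact: bmM.
transitivity (\int[P]_w (`|U w| * h (X i w))%:E)%E.
  by apply: eq_integral => w _; rewrite ger0_norm// mulrC.
rewrite (@tonelli_independent _ _ _ _ _ _ _ P U (X i)
  (fun z => (`|z.1| * h z.2)%:E)); last 3 first.
- exact: fold_stat_indep_next.
- apply/measurable_EFinP; apply: measurable_funM => //.
    exact: measurableT_comp.
  exact: measurableT_comp.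
- by move=> z; rewrite lee_fin mulr_ge0.
transitivity (\int[P]_w' ((\int[P]_w U w) * h (X i w'))%:E)%E.
  apply: eq_integral => w' _ /=.
  rewrite mulrC -expectZl// EFin_expect; last by apply: bmM => //; exact: bm_cst.
  by apply: eq_integral => w _; rewrite ger0_norm; [rewrite mulrC|exact: U0].
rewrite -EFin_expect; last by apply: bmM => //; exact: bm_cst.
by rewrite expectZl// mulrC.
Qed.

End product_expectation.

Section han.
Context {R : realType} {dO dE : measure_display} {Omega : measurableType dO}
  {E : measurableType dE} {P : probability Omega R} {I : choiceType}.

(** The hypothesis on [G] and [g] says that [g (X i)] is, for each [i] in [s],
    the conditional expectation of [G] given [X i]; its right-hand side is written
    with the single variable [X i0] because the [X i] have the same law. The
    inequality is Gibbs' inequality between [G] and the density with the same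
    mass which is a product of functions of the single [X i]. *)
Lemma han_inequality (X : I -> {RV P >-> E}) (mu : probability E R)
    (G : Omega -> R) (g : E -> R) (n : nat) (s : seq I) (i0 : I) :
  mutually_independent X -> (forall i, has_law (X i) mu) ->
  uniq s -> size s = n.+1 ->
  bounded_measurable G -> bounded_measurable g ->
  (forall w, 0 <= G w) -> (forall x, 0 <= g x) ->
  (forall i h, i \in s -> bounded_measurable h ->
    \int[P]_w (G w * h (X i w)) = \int[P]_w (g (X i0 w) * h (X i0 w))) ->
  n.+1%:R * (\int[P]_w (g (X i0 w) * ln (g (X i0 w))))
  <= \int[P]_w (G w * ln (G w))
     + n%:R * ((\int[P]_w G w) * ln (\int[P]_w G w)).
Proof.
move=> indX lawX us sn bG bg G0 g0 condG.
set m := \int[P]_w G w.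
have bcst (r : R) : bounded_measurable (fun _ : Omega => r) by exact: bm_cst.
have bcstE (r : R) : bounded_measurable (fun _ : E => r) by exact: bm_cst.
have bX i (h : E -> R) : bounded_measurable h -> bounded_measurable (fun w => h (X i w)).
  exact: bm_comp.
have m0 : 0 <= m by apply: Rintegral_ge0.
have mg i : \int[P]_w g (X i w) = m.
  transitivity (\int[P]_w g (X i0 w)).
    by apply: expect_eq_law => // A mA; rewrite !lawX.
  have [j js] : exists j, j \in s.
    by case: s sn {us condG} => // j s _; exists j; rewrite inE eqxx.
  have := condG j (fun=> 1) js (bcstE _).
  under [X in X = _]eq_Rintegral do rewrite mulr1.
  by under [X in _ = X]eq_Rintegral do rewrite mulr1.
(* The total error below is (n + 1) e, which is the prescribed slack e'. *)
apply/ler_addgt0Pr => e' e'0.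
pose e := e' / n.+1%:R.
have e0 : 0 < e by rewrite divr_gt0.
have ge0 x : 0 < g x + e by rewrite ltr_wpDl.
have me0 : 0 < m + e by rewrite ltr_wpDl.
pose L x := ln (g x + e).
have bL : bounded_measurable L by exact: bm_ln.
(* The product density of mass m + e, as [EH] shows. *)
pose H w := \prod_(i <- s) (g (X i w) + e) / (m + e) ^+ n.
have bge : bounded_measurable (fun x => g x + e) by exact: bmD.
have bH : bounded_measurable H.
  by apply: bmM => //; apply: bm_prod => i; exact: (bX i _ bge).
have H0 w : 0 < H w by rewrite divr_gt0 ?exprn_gt0// prodr_gt0.
have lnH w : ln (H w) = \sum_(i <- s) L (X i w) - n%:R * ln (m + e).
  by rewrite ln_div ?posrE ?exprn_gt0 ?prodr_gt0// ln_prod// lnXn// mulr_natl.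
have EH : \int[P]_w H w = m + e.
  rewrite /H; under eq_Rintegral do rewrite mulrC.
  rewrite expectZl; last by apply: bm_prod => i; exact: (bX i _ bge).
  rewrite (expect_prod (h := fun x => g x + e))//; last 2 first.
  - by case: bge.
  - by move=> x; exact: ltW.
  rewrite (eq_bigr (fun=> m + e)) => [|i _]; last first.
    by rewrite expectD ?mg ?expect_cst//; exact: bX.
  rewrite big_const_seq count_predT sn iter_mulr mulr1 exprS mulrCA mulVf ?mulr1//.
  by rewrite expf_neq0// gt_eqF.
have bGL i : bounded_measurable (fun w => G w * L (X i w)).
  by apply: bmM => //; exact: bX.
have gibbs : \int[P]_w (\sum_(i <- s) G w * L (X i w)
     - n%:R * ln (m + e) * G w + G w - H w) <= \int[P]_w (G w * ln (G w)).
  apply: le_expect.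
  - apply: bmB => //; apply: bmD => //; apply: bmB; last exact: bmM.
    exact: bm_sum.
  - exact: bm_mul_ln.
  - move=> w; apply: le_trans (gibbs_pointwise (G0 w) (H0 w)).
    by rewrite lnH mulrBr mulr_sumr [_ * G w]mulrC.
have bsum : bounded_measurable (fun w => \sum_(i <- s) G w * L (X i w)).
  exact: bm_sum.
have bmG : bounded_measurable (fun w => n%:R * ln (m + e) * G w) by exact: bmM.
rewrite expectB// ?EH in gibbs; last by apply: bmD => //; exact: bmB.
rewrite expectD// in gibbs; last exact: bmB.
rewrite expectB// expect_sum// expectZl// -/m in gibbs.
have sumE : \sum_(i <- s) \int[P]_w (G w * L (X i w)) =
    n.+1%:R * \int[P]_w (g (X i0 w) * L (X i0 w)).
  rewrite (eq_big_seq _ (fun i si => condG i L si bL)).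
  by rewrite big_const_seq count_predT sn iter_addr addr0 mulr_natl.
have bgX : bounded_measurable (fun w => g (X i0 w)) by exact: bX.
(* Only the argument of the logarithm carries e: the error has the right sign,
   also where g vanishes. *)
have lowerL : \int[P]_w (g (X i0 w) * ln (g (X i0 w))) <=
    \int[P]_w (g (X i0 w) * L (X i0 w)).
  apply: le_expect => [||w]; first exact: bm_mul_ln.
    by apply: bmM => //; exact: bX.
  have := g0 (X i0 w); rewrite le0r => /predU1P[->|gX0]; first by rewrite !mul0r.
  by rewrite ler_pM2l// ler_ln ?posrE// lerDl ltW.
have mlnm := mul_lnD_le m0 e0.
have n0 : 0 <= n%:R :> R by exact: ler0n.
have := ler_wpM2l n0 mlnm.
have := ler_wpM2l (ler0n R n.+1) lowerL.
have -> : e' = n%:R * e + e.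
  by rewrite -[X in _ + X]mul1r -mulrDl natr1 mulrC divfK.
move: gibbs; rewrite sumE -mulrA [ln _ * m]mulrC; lra.
Qed.

End han.

(** * Scaled sums *)

Section sums.
Context {R : realType} {d : nat}.

Definition add_op (z : borelRd R d * borelRd R d) : borelRd R d :=
  (z.1 : 'rV[R]_d) + z.2.

Lemma measurable_add_op : measurable_fun setT add_op.
Proof.
apply: measurable_borelRd => i.
rewrite (_ : (fun _ => _) = fun z : borelRd R d * borelRd R d =>
  (z.1 : 'rV[R]_d) ord0 i + (z.2 : 'rV[R]_d) ord0 i); last first.
  by apply/funext => z; rewrite mxE.
by apply: measurable_funD; exact: (measurableT_comp (measurable_coord i)).
Qed.

HB.instance Definition _ :=
  isMeasurableFun.Build _ _ (borelRd R d * borelRd R d)%type (borelRd R d)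
    add_op measurable_add_op.

Context {dO : measure_display} {Omega : measurableType dO}
  {P : probability Omega R} (X : nat -> {RV P >-> borelRd R d}).

Notation partial_sum := (fold_stat add_op (0 : 'rV[R]_d) X).

Lemma fold_addE s w : (partial_sum s w : 'rV[R]_d) = \sum_(i <- s) (X i w : 'rV[R]_d).
Proof.
elim: s => [|i s IH]; first by rewrite big_nil.
by rewrite big_cons -IH; exact: addrC.
Qed.

Lemma scaled_sumE n w : scaled_sum X n w =
  (Num.sqrt n%:R)^-1 *: (partial_sum (iota 0 n) w : 'rV[R]_d).
Proof.
rewrite fold_addE /scaled_sum.
by rewrite -(big_mkord xpredT (fun i => X i w : 'rV[R]_d)) /index_iota subn0.
Qed.

Lemma measurable_affine (a : R) (y : 'rV[R]_d) : measurable_fun setT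
  (fun x : borelRd R d => a *: (x : 'rV[R]_d) + y : borelRd R d).
Proof.
apply: measurable_borelRd => i.
rewrite (_ : (fun _ => _) = fun x : borelRd R d => a * (x : 'rV[R]_d) ord0 i + y ord0 i).
  by apply: measurable_funD => //; apply: measurable_funM => //; exact: measurable_coord.
by apply/funext => x; rewrite !mxE.
Qed.

Variable mu : probability (borelRd R d) R.
Hypotheses (lawX : forall i, has_law (X i) mu) (indX : mutually_independent X).

(** One step with the same constant: the inequality for the n-th law, applied to
    the sections of [f] obtained by freezing one of the n+1 variables, bounds
    the conditional entropy of f ^ 2 at the scaled sum given that variable; Han's
    inequality bounds the full entropy by these conditional entropies. *)
Lemma log_sobolev_scaled_sumS n C : (0 < n)%N ->
  log_sobolev (distribution P (scaled_sum X n)) C ->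
  log_sobolev (distribution P (scaled_sum X n.+1)) C.
Proof.
move=> n0 lsn f sf cf.
pose c : R := (Num.sqrt n.+1%:R)^-1.
pose a : R := c * Num.sqrt n%:R.
have sqn0 : Num.sqrt n%:R != 0 :> R by rewrite sqrtr_eq0 -ltNge ltr0n.
have sqn10 : Num.sqrt n.+1%:R != 0 :> R by rewrite sqrtr_eq0 -ltNge ltr0n.
have a0 : a != 0 by rewrite mulf_neq0 ?invr_eq0.
have a2 : n.+1%:R * a ^+ 2 = n%:R.
  rewrite /a /c exprMn exprVn !sqr_sqrtr ?ler0n// mulrA mulfV ?pnatr_eq0//.
  by rewrite mul1r.
have bf := bm_test_function sf cf.
have bgrad := bm_sqnorm_grad sf cf.
have df x : differentiable f x by case: (sf 1%N).
have mscale0 : measurable_fun setT (fun x : borelRd R d => c *: (x : 'rV[R]_d) : borelRd R d).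
  by have := measurable_affine c 0; under eq_fun do rewrite addr0.
pose F (y : borelRd R d) : R := f (c *: (y : 'rV[R]_d)) ^+ 2.
pose Gam (y : borelRd R d) : R := sqnorm_grad f (c *: (y : 'rV[R]_d)).
have F0 y : 0 <= F y by exact: sqr_ge0.
have bF : bounded_measurable F.
  exact: (bm_comp mscale0 (bmM bf bf)).
have bGam : bounded_measurable Gam by exact: (bm_comp mscale0 bgrad).
have bphiF : bounded_measurable (fun y => F y * ln (F y)) by exact: bm_mul_ln.
pose T s : {RV P >-> borelRd R d} := partial_sum s.
pose s0 := iota 0 n; pose s1 := iota 0 n.+1.
pose S0 : {RV P >-> borelRd R d} := T s0.
pose S1 : {RV P >-> borelRd R d} := T s1.
pose g (x : borelRd R d) : R := \int[P]_w F (add_op (S0 w, x)).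
have badd (q : borelRd R d -> R) : bounded_measurable q ->
    bounded_measurable (fun z => q (add_op z)).
  by move=> bq; exact: (bm_comp measurable_add_op bq).
have bg : bounded_measurable g by exact: (@bm_section _ _ _ _ _ _ _ _ S0 _ (badd _ bF)).
have g0 x : 0 <= g x by exact: Rintegral_ge0.
have indT s i : uniq (i :: s) -> independent2 (T s) (X i).
  exact: (@fold_stat_indep_next _ _ _ _ _ _ _ P _ add_op (0 : 'rV[R]_d) X indX).
have S1E i w : i \in s1 -> S1 w = add_op (T (rem i s1) w, X i w).
  move=> si; apply: (etrans (fold_addE s1 w)); rewrite (big_rem i si)/= addrC.
  by congr (_ + _); exact/esym/fold_addE.
have us1 : uniq s1 by exact: iota_uniq.
have urem i : i \in s1 -> uniq (i :: rem i s1).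
  by move=> si; rewrite cons_uniq rem_uniq// mem_rem_uniq// inE eqxx.
have szrem i : i \in s1 -> size (rem i s1) = size s0.
  by move=> si; rewrite size_rem// !size_iota.
have lawT i : i \in s1 -> forall A, measurable A ->
    distribution P (T (rem i s1)) A = distribution P S0 A.
  move=> si A mA.
  have ur : uniq (rem i s1) by have := urem i si; rewrite cons_uniq => /andP[].
  exact: (@fold_stat_law _ _ _ _ _ _ _ P _ add_op (0 : 'rV[R]_d) X indX mu _ _
    lawX ur (iota_uniq _ _) (szrem i si) A mA).
have eqlawX (h : borelRd R d -> R) i : bounded_measurable h ->
    \int[P]_w h (X i w) = \int[P]_w h (X n w).
  by move=> bh; apply: expect_eq_law => // A mA; rewrite !lawX.
(* Integrate out the other n variables first: their sum is independent of X_i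
   and has the law of S0, which produces the same g for every i. *)
have condG i (h : borelRd R d -> R) : i \in s1 -> bounded_measurable h ->
    \int[P]_w (F (S1 w) * h (X i w)) = \int[P]_w (g (X n w) * h (X n w)).
  move=> si bh; rewrite -(eqlawX (fun x => g x * h x) i); last exact: bmM.
  pose phi z := F (add_op z) * h z.2.
  have bphi : bounded_measurable phi.
    by apply: bmM; [exact: badd|exact: bm_comp].
  transitivity (\int[P]_w phi (T (rem i s1) w, X i w)).
    by apply: eq_Rintegral => w _; rewrite (S1E i).
  rewrite (fubini_independent _ bphi); last exact: (indT _ _ (urem i si)).
  apply: eq_Rintegral => w' _; rewrite /phi /=.
  have bslice : bounded_measurable (fun y => F (add_op (y, X i w'))).
    by apply: (bm_comp _ (badd _ bF)); exact: measurable_fun_pair.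
  under eq_Rintegral do rewrite mulrC.
  rewrite expectZl; last exact: (bm_comp _ bslice).
  rewrite mulrC; congr (_ * _).
  exact: (expect_eq_law bslice (lawT i si)).
have ns1 : n \in s1 by rewrite mem_iota /= add0n.
have indS0 : independent2 S0 (X n).
  apply: indT.
  by rewrite cons_uniq iota_uniq mem_iota add0n ltnn.
have S1S0 w : S1 w = add_op (S0 w, X n w).
  have s1E : s1 = s0 ++ [:: n] by rewrite /s1 -addn1 iotaD.
  rewrite [LHS](fold_addE s1 w) s1E big_cat big_seq1.
  by congr (_ + _); exact/esym/fold_addE.
have fub (q : borelRd R d -> R) : bounded_measurable q ->
    \int[P]_w q (S1 w) = \int[P]_w' \int[P]_w q (add_op (S0 w, X n w')).
  move=> bq; rewrite -(fubini_independent indS0 (badd _ bq)).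
  by apply: eq_Rintegral => w _; rewrite S1S0.
have han := @han_inequality _ _ _ _ _ P _ X mu (fun w => F (S1 w)) g n s1 n
  indX lawX us1 (size_iota _ _) (bm_comp (measurable_funPT S1) bF) bg
  (fun w => F0 (S1 w)) g0 condG.
(* Freezing the last variable at x turns f into the test function hx, since
   a S_n + c x = c (T_{0..n-1} + x); the factor a ^ 2 is the chain rule. *)
have lsx x : \int[P]_w (F (add_op (S0 w, x)) * ln (F (add_op (S0 w, x)))) - g x * ln (g x)
   <= 2 * C * (a ^+ 2 * \int[P]_w Gam (add_op (S0 w, x))).
  pose hx (s : 'rV[R]_d) : R := f (a *: s + c *: (x : 'rV[R]_d)).
  have maff := measurable_affine a (c *: (x : 'rV[R]_d)).
  have bhx2 : bounded_measurable (fun s : borelRd R d => hx s ^+ 2).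
    exact: (bm_comp maff (bmM bf bf)).
  have hxE w : a *: (scaled_sum X n w : 'rV[R]_d) + c *: (x : 'rV[R]_d) =
      c *: (add_op (S0 w, x) : 'rV[R]_d).
    by rewrite scaled_sumE scalerA /a mulfK// -scalerDr.
  have hx2E w : hx (scaled_sum X n w) ^+ 2 = F (add_op (S0 w, x)).
    by rewrite /hx hxE.
  have bhx : bounded_measurable (fun s : borelRd R d => sqnorm_grad hx s).
    rewrite (_ : (fun _ => _) = fun s : borelRd R d =>
      a ^+ 2 * sqnorm_grad f (a *: (s : 'rV[R]_d) + c *: (x : 'rV[R]_d))).
      by apply: bmM; [exact: bm_cst|exact: (bm_comp maff bgrad)].
    by apply/funext => s; rewrite sqnorm_grad_affine.
  have := lsn hx (@smooth_affine _ _ _ _ _ sf)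
    (@compactly_supported_affine _ _ _ _ _ a0 cf).
  rewrite /Ent_sq !expect_distribution//; last first.
    by apply: bm_mul_ln => // s; exact: sqr_ge0.
  under eq_Rintegral do rewrite hx2E.
  under [X in _ - X * _]eq_Rintegral do rewrite hx2E.
  under [X in _ - _ * ln X]eq_Rintegral do rewrite hx2E.
  under [X in _ <= _ * X]eq_Rintegral do rewrite sqnorm_grad_affine// hxE.
  rewrite expectZl//.
  apply: (bm_comp _ (badd _ bGam)); exact: measurable_fun_pair.
have bgn : bounded_measurable (fun x => g x * ln (g x)) by exact: bm_mul_ln.
have bsecF : bounded_measurable
    (fun x => \int[P]_w (F (add_op (S0 w, x)) * ln (F (add_op (S0 w, x))))).
  exact: (@bm_section _ _ _ _ _ _ _ _ S0 _ (badd _ bphiF)).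
have bsecGam : bounded_measurable (fun x => \int[P]_w Gam (add_op (S0 w, x))).
  exact: (@bm_section _ _ _ _ _ _ _ _ S0 _ (badd _ bGam)).
have bXn (q : borelRd R d -> R) : bounded_measurable q ->
  bounded_measurable (fun w => q (X n w)) by exact: bm_comp.
have lsn_avg : \int[P]_w (F (S1 w) * ln (F (S1 w)))
    - \int[P]_w (g (X n w) * ln (g (X n w)))
    <= 2 * C * (a ^+ 2 * \int[P]_w Gam (S1 w)).
  rewrite (fub (fun y => F y * ln (F y)))// (fub Gam)//.
  rewrite -expectB; [|exact: (bXn _ bsecF)|exact: (bXn _ bgn)].
  rewrite -expectZl; last exact: (bXn _ bsecGam).
  rewrite -expectZl; last by apply: bmM; [exact: bm_cst|exact: (bXn _ bsecGam)].
  apply: le_expect.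
  - exact: (bmB (bXn _ bsecF) (bXn _ bgn)).
  - by do 2 (apply: bmM; first exact: bm_cst); exact: (bXn _ bsecGam).
  - by move=> w; exact: lsx.
have fS w : f (scaled_sum X n.+1 w) ^+ 2 = F (S1 w) by rewrite scaled_sumE.
have gS w : sqnorm_grad f (scaled_sum X n.+1 w) = Gam (S1 w) by rewrite scaled_sumE.
rewrite /Ent_sq !expect_distribution//; last 2 first.
- exact: (bmM bf bf).
- by apply: bm_mul_ln => [s|]; [exact: sqr_ge0|exact: (bmM bf bf)].
under eq_Rintegral do rewrite fS.
under [X in _ - X * _]eq_Rintegral do rewrite fS.
under [X in _ - _ * ln X]eq_Rintegral do rewrite fS.
under [X in _ <= _ * X]eq_Rintegral do rewrite gS.
set U := \int[P]_w (F (S1 w) * ln (F (S1 w))) in han lsn_avg *.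
set V := \int[P]_w (g (X n w) * ln (g (X n w))) in han lsn_avg.
set W := (\int[P]_w F (S1 w)) in han *.
set D := (\int[P]_w Gam (S1 w)) in lsn_avg *.
(* Multiplied by n, the claim is n + 1 times [lsn_avg] plus [han]. *)
have n0R : 0 < n%:R :> R by rewrite ltr0n.
rewrite -(ler_pM2l n0R).
have := ler_wpM2l (ler0n R n.+1) lsn_avg.
rewrite [leRHS](_ : _ = n%:R * (2 * C * D)); last by rewrite -a2; ring.
apply: le_trans; move: han; rewrite -natr1; lra.
Qed.

End sums.

Theorem theorem1p4 (R : realType) (d : nat) (hd : (0 < d)%N)
    (mu : probability (borelRd R d) R)
    (dO : measure_display) (Omega : measurableType dO)
    (P : probability Omega R) (X : nat -> {RV P >-> borelRd R d})
    (hlaw : forall i, has_law (X i) mu)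
    (hind : mutually_independent X) :
  forall n : nat, (0 < n)%N ->
    (C_LS (distribution P (scaled_sum X n.+1))
       <= C_LS (distribution P (scaled_sum X n)))%E.
Proof.
move=> n n0; apply: ereal_inf_le_tmp => _ [C [C0 lsC] <-].
by exists C => //; split => //; exact: (log_sobolev_scaled_sumS hlaw hind n0 lsC).
Qed.
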